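(* For every $L>0$, $u\in\mathcal C$ and $(t,x)\in M$, $$R_0[\Phi_L(u)](t,x)=L\,R_0[u](Lt,Lx),\qquad\text{where}\quad R_0[u]:=\frac{\partial\bar\rho}{\partial t}+\frac{\partial(\bar\rho\,\widetilde u_i)}{\partial x_i}.$$ Consequently, $R_0[\Phi_L(u)]=0$ if and only if $R_0[u]=0$.
   Context: The repeated index $i$ is summed over $1,2,3$. $M=I\times\Omega$ with $I\subset\mathbb R$ an open interval and $\Omega\subset\mathbb R^3$ open, with coordinates $(t,x_1,x_2,x_3)$, such that for every $L>0$ the dilation $\phi_L(t,x)=(Lt,Lx)$ maps $M$ onto $M$. $\mathcal C=C^\infty(M,V)$, $V\cong\mathbb R^{40}$, is the space of smooth field tuples $u=(\bar\rho,\widetilde u_i,\bar p,\bar E,\bar\tau_{ij},\bar q_i,\tau^{\mathrm{sgs}}_{ij},H^{\mathrm{sgs}}_i,\sigma^{\mathrm{sgs}}_{ij},\dot{Q\omega})$, $i,j=1,2,3$, with all components independent real-valued functions. The map $\Phi_L:\mathcal C\to\mathcal C$ is $(\Phi_Lu)(t,x)=(\phi_L^*u)(t,x)=u(Lt,Lx)$, applied to every component. *)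

(* Defs.v *)
From HB Require Import structures.
From mathcomp Require Import all_boot all_order all_algebra.
From mathcomp Require Import all_classical all_reals all_analysis.

Set Implicit Arguments.
Unset Strict Implicit.
Unset Printing Implicit Defensive.

Import Order.TTheory GRing.Theory Num.Theory.
Import numFieldNormedType.Exports.

Local Open Scope classical_set_scope.
Local Open Scope ring_scope.

(* Points are pairs (t, x); the coordinate directions are indexed by
   [option 'I_3], with [None] for t and [Some i] for x_i. *)
Definition coord_dir (R : realType) (a : option 'I_3) : R * 'rV[R]_3 :=
  if a is Some i then (0, delta_mx 0 i) else (1, 0).

Definition partial (R : realType) (W : normedModType R) (a : option 'I_3)
    (f : R * 'rV[R]_3 -> W) : R * 'rV[R]_3 -> W :=
  fun p => 'D_(coord_dir R a) f p.

(* All iterated partial derivatives of order at most k exist and are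
   continuous on M, which is meant to be open. *)
Fixpoint Ck (R : realType) (W : normedModType R) (M : set (R * 'rV[R]_3))
    (k : nat) (f : R * 'rV[R]_3 -> W) : Prop :=
  (forall p, M p -> {for p, continuous f}) /\
  (if k is k'.+1 then
     forall a, (forall p, M p -> derivable f p (coord_dir R a)) /\
               Ck M k' (partial a f)
   else True).

Definition smooth (R : realType) (W : normedModType R)
    (M : set (R * 'rV[R]_3)) (f : R * 'rV[R]_3 -> W) : Prop :=
  forall k, Ck M k f.

Definition dilation (R : realType) (L : R) (p : R * 'rV[R]_3) :
    R * 'rV[R]_3 := (L * p.1, L *: p.2).

Record domain (R : realType) := Domain {
  time_set : set R;
  space_set : set 'rV[R]_3;
  time_set_open : open time_set;
  time_set_itv : is_interval time_set;
  space_set_open : open space_set;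
  dilation_onto : forall L : R, 0 < L ->
    dilation L @` (time_set `*` space_set) = time_set `*` space_set }.

Definition spacetime (R : realType) (D : domain R) : set (R * 'rV[R]_3) :=
  time_set D `*` space_set D.

(* The value space V, of dimension 40; in order: density, velocity, pressure,
   energy, stress, heat flux, subgrid stress, subgrid enthalpy flux, subgrid
   viscous term, heat release rate.  No symmetry is imposed on the tensors. *)
Notation field_val R :=
  (R * 'rV[R]_3 * R * R * 'M[R]_3 * 'rV[R]_3 * 'M[R]_3 * 'rV[R]_3 * 'M[R]_3 * R)%type.

Definition density (R : realType) (v : field_val R) : R :=
  let: (rho, _, _, _, _, _, _, _, _, _) := v in rho.

Definition velocity (R : realType) (v : field_val R) (i : 'I_3) : R :=
  let: (_, vel, _, _, _, _, _, _, _, _) := v in vel 0 i.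

(* Elements of C^oo(M, V) are represented by functions on the whole of
   R * 'rV[R]_3; their values outside M are irrelevant, M being open. *)
Record field (R : realType) (D : domain R) := Field {
  field_fun :> R * 'rV[R]_3 -> field_val R;
  field_smooth : smooth (spacetime D) field_fun }.

Lemma dilation_spacetime (R : realType) (D : domain R) (L : R) (p : R * 'rV[R]_3) :
  0 < L -> spacetime D p -> spacetime D (dilation L p).
Proof. by move=> L_gt0 Dp; rewrite /spacetime -(dilation_onto D L_gt0); exists p. Qed.

Lemma dilation_continuous (R : realType) (L : R) : continuous (@dilation R L).
Proof.
move=> p; apply: (@cvg_pair _ _ _ (nbhs p) (nbhs (L * p.1)) (nbhs (L *: p.2))) => /=.
  by apply: cvgMl_tmp; exact: cvg_fst.
by apply: cvgZl_tmp; exact: cvg_snd.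
Qed.

Lemma is_derive_dilation (R : realType) (W : normedModType R) (L : R)
    (f : R * 'rV[R]_3 -> W) (p v : R * 'rV[R]_3) : 0 < L ->
  derivable f (dilation L p) v ->
  is_derive p v (f \o dilation L) (L *: 'D_v f (dilation L p)).
Proof.
move=> L_gt0 df.
have L_neq0 : L != 0 by rewrite gt_eqF.
have cv : (fun h : R => h^-1 *: ((f \o dilation L \o shift p) (h *: v)
      - (f \o dilation L) p)) @ 0^' --> L *: 'D_v f (dilation L p).
  have cL : (fun h : R => L * h) @ 0^' --> 0^'.
    have {2}-> : 0 = L * 0 :> R by rewrite mulr0.
    apply: continuous_injective_withinNx; first exact: mulrl_continuous.
    by move=> h; apply: (mulfI L_neq0).
  apply: cvg_trans (cvgZl_tmp (k := L) (cvg_comp _ _ cL df)).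
  apply: near_eq_cvg; near=> h => /=.
  rewrite scalerA invfM mulrA divff // mul1r.
  congr (_ *: (f _ - _)).
  rewrite /dilation /shift /=; congr pair; rewrite /=.
    rewrite mulrDr; congr (_ + _); exact/esym/(mulrA L h v.1).
  by rewrite scalerDr scalerA.
by split; [apply/cvg_ex; eexists; exact: cv | exact: cvg_lim cv].
Unshelve. all: by end_near. Qed.

Lemma Ck_dilation (R : realType) (W : normedModType R)
    (M : set (R * 'rV[R]_3)) (L : R) : 0 < L -> open M ->
  (forall p, M p -> M (dilation L p)) ->
  forall k c (f g : R * 'rV[R]_3 -> W),
    (forall p, M p -> g p = c *: f (dilation L p)) -> Ck M k f -> Ck M k g.
Proof.
move=> L_gt0 oM ML k.
have near_gE c (f g : R * 'rV[R]_3 -> W) p :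
    (forall p, M p -> g p = c *: f (dilation L p)) -> M p ->
    \near p, c *: f (dilation L p) = g p.
  move=> gE Mp; have Mnbhs : nbhs p M by exact: open_nbhs_nbhs.
  by apply: filterS Mnbhs => q Mq; rewrite gE.
have g_cont c (f g : R * 'rV[R]_3 -> W) p :
    (forall p, M p -> g p = c *: f (dilation L p)) ->
    (forall p, M p -> {for p, continuous f}) ->
    M p -> {for p, continuous g}.
  move=> gE cf Mp; rewrite /prop_for /continuous_at gE//.
  apply: cvg_trans (near_eq_cvg (near_gE _ _ _ _ gE Mp)) _.
  apply: (@cvgZl_tmp _ _ _ _ _ c (f \o dilation L)).
  by apply: continuous_comp; [exact: dilation_continuous|exact/cf/ML].
elim: k => [|k IHk] c f g gE [cf df].
  by split => // p; exact: g_cont gE cf.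
have dg a p : M p ->
    is_derive p (coord_dir R a) g (c *: (L *: partial a f (dilation L p))).
  move=> Mp; apply: near_eq_is_derive (near_gE _ _ _ _ gE Mp) _.
  apply: is_deriveZ; apply: is_derive_dilation => //.
  by apply: (df a).1; exact: ML.
split=> [p|a]; first exact: g_cont gE cf.
split=> [p Mp|]; first by have [] := dg a p Mp.
apply: (IHk (c * L) (partial a f)); last exact: (df a).2.
by move=> p Mp; rewrite /partial -scalerA; have [_ ->] := dg a p Mp.
Qed.

Lemma spacetime_open (R : realType) (D : domain R) : open (spacetime D).
Proof.
rewrite openE => -[t x] [/= Dt Dx]; exists (time_set D, space_set D) => //=.
by split; apply: open_nbhs_nbhs; split=> //;
   [exact: time_set_open | exact: space_set_open].
Qed.

Lemma smooth_dilation (R : realType) (D : domain R) (L : R) (L_gt0 : 0 < L)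
    (u : field D) : smooth (spacetime D) (u \o dilation L).
Proof.
move=> k; apply: (@Ck_dilation _ _ _ _ L_gt0 (@spacetime_open R D) _ k 1 u).
- by move=> p; exact: dilation_spacetime.
- by move=> p _; rewrite scale1r.
- exact: field_smooth.
Qed.

Definition Phi (R : realType) (D : domain R) (L : R) (L_gt0 : 0 < L)
    (u : field D) : field D :=
  @Field R D (u \o dilation L) (smooth_dilation L_gt0 u).

Definition R0 (R : realType) (D : domain R) (u : field D)
    (p : R * 'rV[R]_3) : R :=
  partial None (fun q => density (u q) : R^o) p +
  \sum_(i < 3) partial (Some i) (fun q => density (u q) * velocity (u q) i : R^o) p.

(* Main.v *)
Require Import Defs.
From HB Require Import structures.
From mathcomp Require Import all_boot all_order all_algebra.
From mathcomp Require Import all_classical all_reals all_analysis.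

Import Order.TTheory GRing.Theory Num.Theory.
Import numFieldNormedType.Exports.

Local Open Scope classical_set_scope.
Local Open Scope ring_scope.

(** The residual [R0] is a sum of first-order partial derivatives, and
    precomposing with the dilation commutes with the algebraic expressions
    (density, density times velocity) under the derivatives.  The chain rule
    for the dilation therefore extracts exactly one factor [L] from each term.
    The chain rule needs the differentiated expressions to be derivable; this
    comes from smoothness of the field, because density and velocity components
    are continuous linear functions on the value space ([derivable_linear_comp])
    and products of derivable real functions are derivable.

    For the equivalence, [L] is invertible and the dilation maps spacetime onto
    itself, so that the scaling identity reaches every point of spacetime. *)

(** A continuous linear map carries the limit of difference quotients to the
    limit of their images, which are again difference quotients. *)
Lemma derivable_linear_comp {R : realType} {U V W : normedModType R}
    (g : V -> W) (f : U -> V) (p v : U) :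
  linear g -> continuous g -> derivable f p v -> derivable (g \o f) p v.
Proof.
move=> g_lin g_cont df.
pose G : {linear V -> W} :=
  HB.pack g (GRing.isLinear.Build R V W *:%R g g_lin).
apply/cvg_ex; exists (g ('D_v f p)).
apply: cvg_trans (cvg_comp _ _ df (g_cont _)).
apply: near_eq_cvg; near=> h => /=.
by rewrite -[g]/(G : V -> W) linearZ linearB.
Unshelve. all: by end_near. Qed.

Lemma density_linear (R : realType) :
  linear (@density R : field_val R -> R^o).
Proof. by move=> a [[[[[[[[[? ?] ?] ?] ?] ?] ?] ?] ?] ?] [[[[[[[[[? ?] ?] ?] ?] ?] ?] ?] ?] ?]. Qed.

Lemma velocity_linear (R : realType) (i : 'I_3) :
  linear (fun v : field_val R => velocity v i : R^o).
Proof.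
move=> a [[[[[[[[[? ?] ?] ?] ?] ?] ?] ?] ?] ?] [[[[[[[[[? ?] ?] ?] ?] ?] ?] ?] ?] ?].
by rewrite /= !mxE.
Qed.

Lemma continuous_fst_comp {T U V : topologicalType} (f : T -> U * V) :
  continuous f -> continuous (fun x => (f x).1).
Proof. by move=> cf x; apply: (continuous_comp (cf x)); exact: cvg_fst. Qed.

Lemma density_velocity_continuous (R : realType) :
  continuous (fun v : field_val R => v.1.1.1.1.1.1.1.1).
Proof. by do 8 apply: continuous_fst_comp; move=> v; exact: cvg_id. Qed.

Lemma density_continuous (R : realType) :
  continuous (@density R : field_val R -> R^o).
Proof.
have -> : (@density R : field_val R -> R^o) =
    fst \o (fun v : field_val R => v.1.1.1.1.1.1.1.1).
  by apply/funext=> -[[[[[[[[[? ?] ?] ?] ?] ?] ?] ?] ?] ?].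
move=> v; apply: continuous_comp; first exact: density_velocity_continuous.
exact: cvg_fst.
Qed.

Lemma velocity_continuous (R : realType) (i : 'I_3) :
  continuous (fun v : field_val R => velocity v i : R^o).
Proof.
have -> : (fun v : field_val R => velocity v i : R^o) =
    (fun x : 'rV[R]_3 => x 0 i) \o snd \o
    (fun v : field_val R => v.1.1.1.1.1.1.1.1).
  by apply/funext=> -[[[[[[[[[? ?] ?] ?] ?] ?] ?] ?] ?] ?].
move=> v; apply: continuous_comp; first exact: density_velocity_continuous.
apply: continuous_comp; first exact: cvg_snd.
exact: coord_continuous.
Qed.

Section Residual.
Context {R : realType} {D : domain R}.
Implicit Types (u : field D) (p : R * 'rV[R]_3) (a : option 'I_3).

Lemma derivable_field u p a :
  spacetime D p -> derivable u p (coord_dir R a).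
Proof. by move=> Dp; have [_ /(_ a)[+ _]] := field_smooth u 1; apply. Qed.

Lemma derivable_density u p a : spacetime D p ->
  derivable (fun q => density (u q) : R^o) p (coord_dir R a).
Proof.
move=> Dp; apply: (derivable_linear_comp (@density R : _ -> R^o) u).
- exact: density_linear.
- exact: density_continuous.
- exact: derivable_field.
Qed.

Lemma derivable_momentum u p a i : spacetime D p ->
  derivable (fun q => density (u q) * velocity (u q) i : R^o) p (coord_dir R a).
Proof.
move=> Dp; apply: derivableM; first exact: derivable_density.
apply: (derivable_linear_comp (fun v => velocity v i : R^o) u).
- exact: velocity_linear.
- exact: velocity_continuous.
- exact: derivable_field.
Qed.

Lemma partial_dilation {W : normedModType R} {L : R} {a}
    {f : R * 'rV[R]_3 -> W} {p} :
  0 < L -> derivable f (dilation L p) (coord_dir R a) ->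
  partial a (f \o dilation L) p = L *: partial a f (dilation L p).
Proof.
by move=> L_gt0 df; rewrite /partial; have [_ ->] := is_derive_dilation L_gt0 df.
Qed.

Lemma R0_Phi {L : R} (L_gt0 : 0 < L) u p : spacetime D p ->
  R0 (Phi L_gt0 u) p = L * R0 u (dilation L p).
Proof.
move=> /(dilation_spacetime L_gt0) DLp.
rewrite /R0 mulrDr mulr_sumr; congr (_ + _).
  exact: partial_dilation L_gt0 (derivable_density u _ _ DLp).
apply: eq_bigr => i _.
exact: partial_dilation L_gt0 (derivable_momentum u _ _ i DLp).
Qed.

End Residual.

Theorem proposition4p1 (R : realType) (D : domain R) (L : R) (L_gt0 : 0 < L)
    (u : field D) :
  (forall (t : R) (x : 'rV[R]_3), spacetime D (t, x) ->
     R0 (Phi L_gt0 u) (t, x) = L * R0 u (L * t, L *: x)) /\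
  ((forall (t : R) (x : 'rV[R]_3), spacetime D (t, x) -> R0 (Phi L_gt0 u) (t, x) = 0) <->
   (forall (t : R) (x : 'rV[R]_3), spacetime D (t, x) -> R0 u (t, x) = 0)).
Proof.
split; first by move=> t x Dtx; exact: R0_Phi.
split=> R0_eq0 t x Dtx.
  have : (dilation L @` spacetime D) (t, x).
    by rewrite /spacetime (dilation_onto D L_gt0).
  move=> [[s y] Dsy <-]; apply: (mulfI (lt0r_neq0 L_gt0)).
  by rewrite mulr0 -(R0_Phi L_gt0)// R0_eq0.
rewrite R0_Phi// R0_eq0 ?mulr0//.
exact: (dilation_spacetime L_gt0 Dtx).
Qed.
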